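(* If $n\ge 6$, then for every $p$ with $1\le p\le n-4$ the iterated line graphs $\mathcal{L}^k\big(Ka_n(p)\big)$ have property $\varrho$ for every $k\ge 1$.
   Context: For $n\ge 3$, let $v$ be a vertex of the complete graph $K_n$ and $e_1,\dots,e_p$ ($1\le p\le n-1$) distinct edges incident to $v$; $Ka_n(p)$ is the graph obtained from $K_n$ by deleting $e_1,\dots,e_p$. $\mathcal{L}^k$ is the $k$-th iterated line graph. A graph has property $\varrho$ if all its negative adjacency eigenvalues equal $-2$. *)

(* Defs.v *)
From HB Require Import structures.
From mathcomp Require Import all_boot all_order all_algebra.
From mathcomp Require Import reals.

Set Implicit Arguments.
Unset Strict Implicit.
Unset Printing Implicit Defensive.

Import Order.TTheory GRing.Theory Num.Theory.

Record sgraph := SGraph {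
  vertex :> finType;
  adj : rel vertex;
  adj_sym : symmetric adj;
  adj_irrefl : irreflexive adj }.

Arguments adj : clear implicits.

Definition edges (G : sgraph) : {set {set G}} :=
  [set e : {set G} | [exists x, exists y, adj G x y && (e == [set x; y])]].

Definition edges_at (G : sgraph) (v : G) : {set {set G}} :=
  [set e in edges G | v \in e].

Section Complete.
Variable n : nat.

Definition complete_adj : rel 'I_n := fun x y => x != y.

Lemma complete_adj_sym : symmetric complete_adj.
Proof. by move=> x y; rewrite /complete_adj eq_sym. Qed.

Lemma complete_adj_irrefl : irreflexive complete_adj.
Proof. by move=> x; rewrite /complete_adj eqxx. Qed.

Definition complete_graph : sgraph :=
  SGraph complete_adj_sym complete_adj_irrefl.
End Complete.

Section DeleteEdges.
Variables (G : sgraph) (D : {set {set G}}).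

Definition delete_adj : rel G :=
  fun x y => adj G x y && ([set x; y] \notin D).

Lemma delete_adj_sym : symmetric delete_adj.
Proof. by move=> x y; rewrite /delete_adj adj_sym setUC. Qed.

Lemma delete_adj_irrefl : irreflexive delete_adj.
Proof. by move=> x; rewrite /delete_adj adj_irrefl. Qed.

Definition delete_edges : sgraph := SGraph delete_adj_sym delete_adj_irrefl.
End DeleteEdges.

(* G is a copy of Ka_n(p); the choice of the vertex v and of the p edges at v
   only matters up to isomorphism, so every choice is admitted. *)
Definition is_Ka (n p : nat) (G : sgraph) : Prop :=
  exists (v : complete_graph n) (D : {set {set complete_graph n}}),
    [/\ D \subset edges_at v, #|D| = p & G = delete_edges D].

Section LineGraph.
Variable G : sgraph.

Definition line_adj : rel {e : {set G} | e \in edges G} :=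
  fun e f => (e != f) && (val e :&: val f != set0).

Lemma line_adj_sym : symmetric line_adj.
Proof. by move=> e f; rewrite /line_adj eq_sym setIC. Qed.

Lemma line_adj_irrefl : irreflexive line_adj.
Proof. by move=> e; rewrite /line_adj eqxx. Qed.

Definition line_graph : sgraph := SGraph line_adj_sym line_adj_irrefl.
End LineGraph.

Definition iterated_line_graph (k : nat) (G : sgraph) : sgraph :=
  iter k line_graph G.

Local Open Scope ring_scope.

Definition adjacency_matrix (R : realType) (G : sgraph) : 'M[R]_#|G| :=
  \matrix_(i, j) (adj G (enum_val i) (enum_val j))%:R.

Definition property_rho (R : realType) (G : sgraph) : Prop :=
  forall a : R, eigenvalue (adjacency_matrix R G) a -> a < 0 -> a = - 2%:R.

(* Main.v *)
(** Let [B] be the incidence matrix of a graph [G], [Q = B B^T] its signless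
    Laplacian (degrees plus adjacency) and [A] the adjacency matrix of its line
    graph. Since [B^T B = 2 + A], each eigenvalue [a] of [A] other than -2
    gives the eigenvalue [a + 2] of [Q], so the line graph has property rho as
    soon as [Q >= 2]. If [G] is itself a line graph of minimum degree at least
    4 this is clear: by the same identity [Q - 2] is the sum of the diagonal
    matrix [degrees - 4] and of a Gram matrix; and the line graph of a graph of
    minimum degree at least 3 has minimum degree at least 4. For [G = Ka_n(p)],
    where all vertices but [v] form a clique, [Q >= 2] reads
    [2 t^2 <= (n - 5) sum y^2 + (sum y)^2 + sum_(x ~ v) (y x + t)^2] with [t]
    the value at [v] and the first two sums ranging over [x <> v]; this holds
    because [v] has at least 3 neighbors. *)

Require Import Defs.
From HB Require Import structures.
From mathcomp Require Import all_boot all_order all_algebra.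
From mathcomp Require Import reals.
From mathcomp Require Import ring lra zify.

Set Implicit Arguments.
Unset Strict Implicit.
Unset Printing Implicit Defensive.

Import Order.TTheory GRing.Theory Num.Theory.

Lemma set2_injr (T : finType) (x : T) : injective (fun z => [set x; z]).
Proof.
move=> z w /setP xz_xw; have := xz_xw z; have := xz_xw w.
by rewrite !inE !eqxx !orbT => /orP[/eqP->|/eqP//] /esym/orP[] /eqP.
Qed.

Section Graph.
Variable G : sgraph.
Implicit Types (x z : G) (s : {set G}).

Definition neighbors x : {set G} := [set z | adj G x z].

Definition degree x : nat := #|neighbors x|.

Lemma adj_neq x z : adj G x z -> x != z.
Proof. by apply: contraTneq => ->; rewrite adj_irrefl. Qed.

Lemma neighbors_sub_setC1 x : neighbors x \subset [set~ x].
Proof. by apply/subsetP=> z; rewrite !inE => /adj_neq; rewrite eq_sym. Qed.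

Lemma edgesP s :
  reflect (exists x z, adj G x z /\ s = [set x; z]) (s \in edges G).
Proof.
rewrite inE; apply: (iffP existsP) => [[x /existsP[z /andP[xz /eqP->]]]|].
  by exists x, z.
by case=> x [z [xz ->]]; exists x; apply/existsP; exists z; rewrite xz eqxx.
Qed.

Lemma card_edge s : s \in edges G -> #|s| = 2.
Proof. by case/edgesP=> x [z [xz ->]]; rewrite cards2 adj_neq. Qed.

Lemma mem_edges_set2 x z : ([set x; z] \in edges G) = adj G x z.
Proof.
apply/idP/idP => [xzG|xz]; last by apply/edgesP; exists x, z.
have : x != z by have := card_edge xzG; rewrite cards2; case: eqP.
have [a [b [ab xz_ab]]] := edgesP _ xzG.
have := set22 x z; have := set21 x z; rewrite xz_ab.
by case/set2P=> -> /set2P[] -> //; rewrite ?eqxx // adj_sym.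
Qed.

Lemma edge_eq_set2 s x z :
  s \in edges G -> x != z -> x \in s -> z \in s -> s = [set x; z].
Proof.
move=> /card_edge s2 xz xs zs; apply/eqP.
by rewrite eq_sym eqEcard s2 cards2 xz andbT subUset !sub1set xs zs.
Qed.

Lemma mem_edges_at x s : (s \in edges_at x) = (s \in edges G) && (x \in s).
Proof. exact: in_set. Qed.

Lemma edges_at_imset x : edges_at x = [set [set x; z] | z in neighbors x].
Proof.
apply/setP => s; rewrite mem_edges_at.
apply/andP/imsetP => [[]|[z xz ->]].
  case/edgesP=> a [b [ab ->]] /set2P[] ->; first by exists b; rewrite ?inE.
  by exists a; rewrite 1?setUC // inE adj_sym.
by rewrite mem_edges_set2 set21 -in_set.
Qed.

Lemma card_edges_at x : #|edges_at x| = degree x.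
Proof. by rewrite edges_at_imset card_imset //; apply: set2_injr. Qed.

Lemma card_edges_atI x z : x != z -> #|edges_at x :&: edges_at z| = adj G x z.
Proof.
move=> xz; have : edges_at x :&: edges_at z \subset [set [set x; z]].
  apply/subsetP=> s /setIP[/setIdP[sG xs] /setIdP[_ zs]].
  by rewrite in_set1 (edge_eq_set2 sG xz).
have <- : ([set x; z] \in edges_at x :&: edges_at z) = adj G x z.
  by rewrite in_setI !mem_edges_at mem_edges_set2 set21 set22 !andbT andbb.
by rewrite subset1 => /orP[] /eqP->; rewrite ?cards1 ?set11 ?cards0 ?in_set0.
Qed.

End Graph.

Section LineGraph.
Variable G : sgraph.
Implicit Types (x z : G) (e f : line_graph G).

Lemma card_edgeI e f : e != f -> #|val e :&: val f| = adj (line_graph G) e f.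
Proof.
move=> ef; rewrite /= /line_adj ef -card_gt0 /=.
suff : #|val e :&: val f| <= 1 by case: #|_| => [|[]].
rewrite leqNgt; apply: contra ef.
case/card_gt1P=> x [z [/setIP[xe xf] /setIP[ze zf] xz]].
apply/eqP/val_inj.
by rewrite (edge_eq_set2 (valP e) xz xe ze) (edge_eq_set2 (valP f) xz xf zf).
Qed.

Lemma degree_line_graph e x z :
  val e = [set x; z] -> degree e + 2 = degree x + degree z.
Proof.
move=> e_xz; have xz : adj G x z by rewrite -mem_edges_set2 -e_xz (valP e).
have val_neighbors : val @: neighbors e = (edges_at x :|: edges_at z) :\ val e.
  apply/setP=> s; rewrite in_setD1 in_setU !mem_edges_at -andb_orr.
  apply/imsetP/and3P => [[f ef ->]|[se sG xzs]].
    move: ef; rewrite inE => /andP[ef /set0Pn[w /setIP[we wf]]].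
    split; [by rewrite eq_sym | exact: valP |].
    by move: we wf; rewrite e_xz => /set2P[] -> ->; rewrite ?orbT.
  exists (Sub s sG) => //; rewrite inE /= /line_adj -val_eqE eq_sym se /= e_xz.
  by case/orP: xzs => ws; apply/set0Pn; [exists x | exists z];
    rewrite in_setI ws ?set21 ?set22.
have e_star : val e \in edges_at x :|: edges_at z.
  by rewrite in_setU mem_edges_at (valP e) e_xz set21.
rewrite -(card_edges_at x) -(card_edges_at z) -cardsUI.
rewrite card_edges_atI ?adj_neq // xz.
rewrite (cardsD1 (val e)) e_star -val_neighbors card_imset; last exact: val_inj.
by rewrite addn2 add1n addn1.
Qed.

Lemma card_line_graph_set (P : pred {set G}) :
  #|[set e : line_graph G | P (val e)]| = #|[set s in edges G | P s]|.
Proof. by rewrite -!sum1dep_card big_sub_cond. Qed.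

Lemma degree_line_graph_geq m :
  (forall x, m <= degree x) -> forall e, m.*2 - 2 <= degree e.
Proof.
move=> deg_ge e; have [x [z [_ e_xz]]] := edgesP _ (valP e).
have deg_e := degree_line_graph e_xz; have := deg_ge x; have := deg_ge z.
by lia.
Qed.

End LineGraph.

Lemma degree_iterated_line_graph_geq (G : sgraph) m k :
  2 <= m -> (forall x : G, m <= degree x) ->
  forall x : iterated_line_graph k G, m <= degree x.
Proof.
move=> m_ge2 deg_ge; elim: k => // k deg_k e.
by apply: leq_trans (degree_line_graph_geq deg_k e); lia.
Qed.

Section DeleteEdges.
Variables (G : sgraph) (v : G) (D : {set {set G}}).

Lemma edges_delete_edges : edges (delete_edges D) = edges G :\: D.
Proof.
apply/setP=> s; rewrite in_setD.
apply/edgesP/andP => [[x [z [/andP[xz xzD] ->]]]|[sD /(@edgesP G)]].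
  by split=> //; apply/(@edgesP G); exists x, z.
by case=> x [z [xz s_xz]]; exists x, z; rewrite /= /delete_adj xz -s_xz.
Qed.

Lemma edges_at_delete_edges : @edges_at (delete_edges D) v = edges_at v :\: D.
Proof. by rewrite /edges_at edges_delete_edges !setIdE setIDAC. Qed.

Lemma degree_delete_edges :
  D \subset edges_at v -> @degree (delete_edges D) v + #|D| = degree v.
Proof.
move=> Dv; rewrite -!card_edges_at edges_at_delete_edges.
by rewrite cardsD (setIidPr Dv) subnK ?subset_leq_card.
Qed.

End DeleteEdges.

Section Clique.
Variable G : sgraph.
Implicit Types (A : {set G}) (v x : G).

Definition clique A : Prop := {in A &, forall x z, adj G x z = (x != z)}.

Lemma clique_degree_geq A x : clique A -> x \in A -> #|A|.-1 <= degree x.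
Proof.
move=> cliqueA xA; rewrite (cardsD1 x) xA; apply/subset_leq_card/subsetP=> z.
by rewrite !inE => /andP[zx zA]; rewrite cliqueA // eq_sym.
Qed.

Lemma clique_setC1_degree_geq m v :
  clique [set~ v] -> m + 2 <= #|G| -> m <= degree v -> forall x, m <= degree x.
Proof.
move=> cliqueC cardG deg_v x; have [->//|xv] := eqVneq x v.
have xC : x \in [set~ v] by rewrite in_setC1.
by have := clique_degree_geq cliqueC xC; rewrite cardsC1; lia.
Qed.

End Clique.

Lemma clique_delete_edges_at (G : sgraph) (v : G) (D : {set {set G}}) :
  D \subset edges_at v -> clique [set: G] ->
  @clique (delete_edges D) [set~ (v : delete_edges D)].
Proof.
move=> /subsetP Dv cliqueG x z; rewrite !in_setC1 => xv zv.
rewrite /= /delete_adj cliqueG ?in_setT // andb_idr // => _.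
apply/negP=> /Dv; rewrite mem_edges_at => /andP[_ /set2P[] v_eq].
  by rewrite v_eq eqxx in xv.
by rewrite v_eq eqxx in zv.
Qed.

Lemma clique_complete_graph n : clique [set: complete_graph n].
Proof. by []. Qed.

Lemma degree_complete_graph n (v : complete_graph n) : degree v = n.-1.
Proof.
rewrite -[in RHS](card_ord n) -(cardsC1 v); apply: eq_card => z.
by rewrite !inE eq_sym.
Qed.

Lemma is_Ka_clique n p (G : sgraph) :
  is_Ka n p G ->
  exists v : G, [/\ clique [set~ v], #|G| = n & degree v + p = n.-1].
Proof.
case=> v [D [Dv <- ->]]; exists v; split.
- exact: clique_delete_edges_at (@clique_complete_graph n).
- exact: card_ord.
- by rewrite degree_delete_edges // degree_complete_graph.
Qed.

Local Open Scope ring_scope.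

Lemma sumr_setC1 (V : nmodType) (T : finType) (v : T) (F : T -> V) :
  \sum_x F x = F v + \sum_(x in [set~ v]) F x.
Proof.
by rewrite (bigD1 v) //=; congr (_ + _); apply: eq_bigl => x; rewrite in_setC1.
Qed.

Lemma sumr_enum_rank (V : nmodType) (T : finType) (F : 'I_#|T| -> V) :
  \sum_i F i = \sum_x F (enum_rank x).
Proof. exact: reindex (onW_bij _ (@enum_rank_bij T)). Qed.

Lemma sumr_enum_val_bool (R : nzSemiRingType) (T : finType) (P : pred T) :
  \sum_(i < #|T|) (P (enum_val i))%:R = #|[set x | P x]|%:R :> R.
Proof.
rewrite -(big_enum_val (fun x => (P x)%:R)) -natr_sum -big_mkcond.
by rewrite sum1dep_card.
Qed.

Section PositiveSemidefinite.
Variable R : realFieldType.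
Implicit Types m n : nat.

Definition psdmx n (M : 'M[R]_n) : Prop :=
  forall u : 'rV_n, 0 <= (u *m M *m u^T) 0 0.

Lemma psdmxD n (M N : 'M[R]_n) : psdmx M -> psdmx N -> psdmx (M + N).
Proof. by move=> Mpsd Npsd u; rewrite mulmxDr mulmxDl mxE addr_ge0. Qed.

Lemma mulmx_tr_sum_sqr n (u : 'rV[R]_n) : (u *m u^T) 0 0 = \sum_i u 0 i ^+ 2.
Proof. by rewrite mxE; apply: eq_bigr => i _; rewrite mxE. Qed.

Lemma psdmx_mul_tr m n (M : 'M[R]_(m, n)) : psdmx (M *m M^T).
Proof.
move=> u; rewrite mulmxA -mulmxA -trmx_mul mulmx_tr_sum_sqr.
by apply: sumr_ge0 => i _; rewrite sqr_ge0.
Qed.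

Lemma psdmx_diag n (d : 'rV[R]_n) : (forall i, 0 <= d 0 i) -> psdmx (diag_mx d).
Proof.
move=> d_ge0 u; rewrite mul_mx_diag mxE; apply: sumr_ge0 => i _.
by rewrite !mxE mulrAC -expr2 mulr_ge0 ?sqr_ge0.
Qed.

Lemma psdmx_eigenvalue_ge n (M : 'M[R]_n) c a :
  psdmx (M - c%:M) -> eigenvalue M a -> c <= a.
Proof.
move=> psd /eigenvalueP[u uM u0]; have := psd u.
rewrite mulmxBr uM mul_mx_scalar -scalerBl -scalemxAl mxE mulmx_tr_sum_sqr.
have sqr_u_ge0 i : true -> 0 <= u 0 i ^+ 2 by rewrite sqr_ge0.
rewrite pmulr_lge0 ?subr_ge0 // lt_neqAle eq_sym sumr_ge0 // andbT.
have /rV0Pn[i ui] := u0; apply: contra ui => /eqP/(psumr_eq0P sqr_u_ge0) u2.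
by rewrite -sqrf_eq0 u2.
Qed.

End PositiveSemidefinite.

Section SignlessLaplacian.
Variable R : realType.
Implicit Type G : sgraph.

Definition degree_matrix G : 'M[R]_#|G| :=
  diag_mx (\row_i (degree (enum_val i))%:R).

Definition signless_laplacian G : 'M[R]_#|G| :=
  degree_matrix G + adjacency_matrix R G.

Definition signless_form G (y : G -> R) : R :=
  \sum_x \sum_(z | adj G x z) (y x + y z) * y x.

Definition incidence_matrix G : 'M[R]_(#|G|, #|line_graph G|) :=
  \matrix_(i, j) ((enum_val i : G) \in val (enum_val j : line_graph G))%:R.

Lemma incidence_mul_tr G :
  incidence_matrix G *m (incidence_matrix G)^T = signless_laplacian G.
Proof.
apply/matrixP=> i j; rewrite !mxE.
under eq_bigr do rewrite !mxE -natrM mulnb.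
set x := enum_val i; set z := enum_val j.
rewrite (sumr_enum_val_bool R
  (fun e : line_graph G => (x \in val e) && (z \in val e))).
rewrite (card_line_graph_set (fun s => (x \in s) && (z \in s))).
have -> : [set s in edges G | (x \in s) && (z \in s)] =
    edges_at x :&: edges_at z.
  by apply/setP=> s; rewrite in_setI !mem_edges_at in_set andbACA andbb.
rewrite -(inj_eq enum_val_inj) -/x -/z; have [<-|xz] := eqVneq x z.
  by rewrite setIid card_edges_at adj_irrefl addr0.
by rewrite card_edges_atI ?add0r.
Qed.

Lemma incidence_tr_mul G :
  (incidence_matrix G)^T *m incidence_matrix G =
  2%:M + adjacency_matrix R (line_graph G).
Proof.
apply/matrixP=> i j; rewrite !mxE.
under eq_bigr do rewrite !mxE -natrM mulnb.
set e := enum_val i; set f := enum_val j.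
rewrite (sumr_enum_val_bool R (fun x : G => (x \in val e) && (x \in val f))).
have -> : [set x | (x \in val e) && (x \in val f)] = val e :&: val f.
  by apply/setP=> x; rewrite !inE.
rewrite -(inj_eq enum_val_inj) -/e -/f; have [<-|ef] := eqVneq e f.
  by rewrite setIid (card_edge (valP e)) adj_irrefl addr0.
by rewrite card_edgeI ?add0r.
Qed.

Lemma eigenvalue_line_graph G a :
  eigenvalue (adjacency_matrix R (line_graph G)) a -> a != - 2%:R ->
  eigenvalue (signless_laplacian G) (a + 2).
Proof.
case/eigenvalueP=> u uA u0; rewrite -addr_eq0 => a2.
set B := incidence_matrix G.
have uBB : u *m B^T *m B = (a + 2) *: u.
  by rewrite -mulmxA incidence_tr_mul mulmxDr uA mul_mx_scalar -scalerDl addrC.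
apply/eigenvalueP; exists (u *m B^T).
  by rewrite -incidence_mul_tr mulmxA uBB scalemxAl.
apply: contra_neq u0 => uB0; move/esym/eqP: uBB.
by rewrite uB0 mul0mx scaler_eq0 (negbTE a2) => /eqP.
Qed.

Lemma property_rho_line_graph G :
  psdmx (signless_laplacian G - 2%:M) -> property_rho R (line_graph G).
Proof.
move=> psd a eigen_a; apply: contraTeq => /(eigenvalue_line_graph eigen_a).
by move=> /(psdmx_eigenvalue_ge psd); rewrite -leNgt lerDr.
Qed.

Lemma psdmx_signless_laplacian_line_graph G c :
  (forall e : line_graph G, c + 2 <= (degree e)%:R) ->
  psdmx (signless_laplacian (line_graph G) - c%:M).
Proof.
move=> deg_ge; set L := line_graph G.
have -> : signless_laplacian L - c%:M =
    (degree_matrix L - (c + 2)%:M) + (2%:M + adjacency_matrix R L).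
  by rewrite addrA (raddfD (@scalar_mx R _)) opprD !addrA subrK addrAC.
apply: psdmxD; last first.
  rewrite -incidence_tr_mul -{2}[incidence_matrix G]trmxK.
  exact: psdmx_mul_tr.
rewrite -diag_const_mx -raddfB /=; apply: psdmx_diag => i.
by rewrite !mxE subr_ge0.
Qed.

Lemma mulmx_signless_laplacian G (u : 'rV[R]_#|G|) (x : G) :
  (u *m signless_laplacian G) 0 (enum_rank x) =
  \sum_(z | adj G x z) (u 0 (enum_rank x) + u 0 (enum_rank z)).
Proof.
rewrite mulmxDr mul_mx_diag !mxE enum_rankK big_split /= sumr_const mulr_natr.
congr (_ *+ _ + _); first by apply: eq_card => z; rewrite inE.
rewrite sumr_enum_rank [RHS]big_mkcond /=.
by apply: eq_bigr => z _; rewrite mxE !enum_rankK adj_sym; case: adj;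
  rewrite ?mulr1 ?mulr0.
Qed.

Lemma psdmx_signless_laplacian_sub G c :
  (forall y : G -> R, c * \sum_x y x ^+ 2 <= signless_form y) ->
  psdmx (signless_laplacian G - c%:M).
Proof.
move=> gap u; pose y x := u 0 (enum_rank x).
have norm_y : (u *m u^T) 0 0 = \sum_x y x ^+ 2.
  by rewrite mulmx_tr_sum_sqr sumr_enum_rank.
have form_y : (u *m signless_laplacian G *m u^T) 0 0 = signless_form y.
  rewrite mxE sumr_enum_rank; apply: eq_bigr => x _.
  by rewrite mulmx_signless_laplacian [u^T _ _]mxE mulr_suml.
rewrite mulmxBr mulmxBl mul_mx_scalar -scalemxAl mxE [X in _ + X]mxE.
by rewrite [X in _ - X]mxE norm_y form_y subr_ge0.
Qed.

End SignlessLaplacian.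

Section ShiftedSquares.
Variables (R : realFieldType) (T : finType) (y : T -> R) (t : R).
Implicit Types A N : {set T}.

Lemma sum_sqr_shift_ge N b :
  b * #|N|%:R * t ^+ 2 <=
  (b + 1) * (b * (\sum_(x in N) y x ^+ 2) + \sum_(x in N) (y x + t) ^+ 2).
Proof.
rewrite mulrAC mulr_natr -sumr_const [b * \sum_(_ in _) _]mulr_sumr -big_split.
rewrite mulr_sumr; apply: ler_sum => x _ /=; rewrite -subr_ge0.
have -> : (b + 1) * (b * y x ^+ 2 + (y x + t) ^+ 2) - b * t ^+ 2 =
    ((b + 1) * y x + t) ^+ 2 by ring.
exact: sqr_ge0.
Qed.

Variables A N : {set T}.
Hypotheses (NA : N \subset A) (N3 : (3 <= #|N|)%N).

Local Notation sum_y := (\sum_(x in A) y x).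
Local Notation sum_sqr_y := (\sum_(x in A) y x ^+ 2).
Local Notation sum_sqr_shift := (\sum_(x in N) (y x + t) ^+ 2).

Lemma sqr_le_sum_sqr_shift_card_ge6 : (6 <= #|A|)%N ->
  2 * t ^+ 2 <= (#|A|%:R - 4) * sum_sqr_y + sum_sqr_shift.
Proof.
move=> A6; have sqr_y_ge0 x : 0 <= y x ^+ 2 by apply: sqr_ge0.
have sum_sqr_N : \sum_(x in N) y x ^+ 2 <= sum_sqr_y.
  by rewrite [leRHS](big_setID N) /= (setIidPr NA) lerDl sumr_ge0.
have card_A : 2 * sum_sqr_y <= (#|A|%:R - 4) * sum_sqr_y.
  by rewrite ler_wpM2r ?sumr_ge0 // lerBrDr -natrD ler_nat.
have card_N : 3 * t ^+ 2 <= #|N|%:R * t ^+ 2.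
  by rewrite ler_wpM2r ?sqr_ge0 // ler_nat.
by have := sum_sqr_shift_ge N 2; lra.
Qed.

(* For [#|N| = 3] equality holds at [y = - t / 3] on [N] and [y = t / 3] off
   [N]; there [sum_y = - t / 3], and bounding [sum_y ^+ 2] by its tangent at
   that value decouples the points of [A]. *)
Lemma sqr_le_sum_sqr_shift_card5 : #|A| = 5 ->
  2 * t ^+ 2 <= sum_sqr_y + sum_y ^+ 2 + sum_sqr_shift.
Proof.
move=> A5.
have tangent : - (2/3 * t * sum_y + t ^+ 2 / 9) <= sum_y ^+ 2.
  by have := sqr_ge0 (sum_y + t / 3); lra.
have on_N : #|N|%:R * (7/9 * t ^+ 2) <=
    \sum_(x in N) (y x ^+ 2 - 2/3 * t * y x + (y x + t) ^+ 2).
  rewrite mulr_natl -sumr_const; apply: ler_sum => x _.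
  by have := sqr_ge0 (y x + t / 3); lra.
have off_N : #|A :\: N|%:R * - (t ^+ 2 / 9) <=
    \sum_(x in A :\: N) (y x ^+ 2 - 2/3 * t * y x).
  rewrite mulr_natl -sumr_const; apply: ler_sum => x _.
  by have := sqr_ge0 (y x - t / 3); lra.
have card_off_N : #|A :\: N|%:R = 5 - #|N|%:R :> R.
  by rewrite cardsDS // natrB ?subset_leq_card // A5.
have card_N : 3 * t ^+ 2 <= #|N|%:R * t ^+ 2.
  by rewrite ler_wpM2r ?sqr_ge0 // ler_nat.
have split_N : sum_sqr_y - 2/3 * t * sum_y + sum_sqr_shift =
    \sum_(x in N) (y x ^+ 2 - 2/3 * t * y x + (y x + t) ^+ 2) +
    \sum_(x in A :\: N) (y x ^+ 2 - 2/3 * t * y x).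
  rewrite mulr_sumr -sumrB [X in X + _](big_setID N) /= (setIidPr NA).
  by rewrite [in RHS]big_split /= addrAC.
by rewrite card_off_N in off_N; lra.
Qed.

Lemma sqr_le_sum_sqr_shift : (5 <= #|A|)%N ->
  2 * t ^+ 2 <= (#|A|%:R - 4) * sum_sqr_y + sum_y ^+ 2 + sum_sqr_shift.
Proof.
rewrite leq_eqVlt => /predU1P[A5|/sqr_le_sum_sqr_shift_card_ge6].
  have -> : #|A|%:R - 4 = 1 :> R by rewrite -A5 -natrB.
  by rewrite mul1r sqr_le_sum_sqr_shift_card5.
by move/le_trans; apply; rewrite lerD2r lerDl sqr_ge0.
Qed.

End ShiftedSquares.

Section CliqueOffVertex.
Variables (R : realType) (G : sgraph).
Implicit Types (A : {set G}) (v : G).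

Lemma clique_sum_neighbors (V : zmodType) A x (F : G -> V) :
  clique A -> x \in A ->
  \sum_(z in A | adj G x z) F z = \sum_(z in A) F z - F x.
Proof.
move=> cliqueA xA; rewrite [in RHS](big_setD1 x) //= [F x + _]addrC addrK.
apply: eq_bigl => z; rewrite !inE andbC; apply: andb_id2r => zA.
by rewrite cliqueA // eq_sym.
Qed.

Lemma clique_setC1_sum_neighbors (V : zmodType) v x (F : G -> V) :
  clique [set~ v] -> x != v ->
  \sum_(z | adj G x z) F z =
  (if x \in neighbors v then F v else 0) + (\sum_(z in [set~ v]) F z - F x).
Proof.
move=> cliqueC; rewrite -in_setC1 => xC.
rewrite -(clique_sum_neighbors _ cliqueC) // big_mkcond (sumr_setC1 v) /=.
by rewrite inE adj_sym -big_mkcondr.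
Qed.

Lemma signless_form_clique_setC1 v (y : G -> R) : clique [set~ v] ->
  signless_form y =
  (#|[set~ v]|%:R - 2) * (\sum_(x in [set~ v]) y x ^+ 2) +
  (\sum_(x in [set~ v]) y x) ^+ 2 +
  \sum_(x in neighbors v) (y x + y v) ^+ 2.
Proof.
move=> cliqueC; set s := \sum_(x in [set~ v]) y x.
have row x : x \in [set~ v] -> \sum_(z | adj G x z) (y x + y z) * y x =
    (if x \in neighbors v then (y x + y v) * y x else 0) +
    ((#|[set~ v]|%:R - 2) * y x ^+ 2 + s * y x).
  rewrite in_setC1 => /(clique_setC1_sum_neighbors _ cliqueC) ->.
  by congr (_ + _); rewrite -mulr_suml big_split /= sumr_const -/s; ring.
rewrite /signless_form (sumr_setC1 v) (eq_bigr _ row) !big_split /=.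
rewrite -big_mkcondr -!mulr_sumr -/s addrA addrC -expr2; congr (_ + _).
have -> : \sum_(x in [set~ v] | x \in neighbors v) (y x + y v) * y x =
    \sum_(x | adj G v x) (y x + y v) * y x.
  apply: eq_bigl => x.
  by rewrite -in_setI (setIidPr (neighbors_sub_setC1 v)) inE.
under [RHS]eq_bigl do rewrite inE.
by rewrite -big_split; apply: eq_bigr => x _ /=; ring.
Qed.

Lemma psdmx_signless_laplacian_clique_setC1 v :
  clique [set~ v] -> (6 <= #|G|)%N -> (3 <= degree v)%N ->
  psdmx (signless_laplacian R G - 2%:M).
Proof.
move=> cliqueC cardG deg_v; apply: psdmx_signless_laplacian_sub => y.
have cardC : (5 <= #|[set~ v]|)%N by rewrite cardsC1; lia.
have := sqr_le_sum_sqr_shift y (y v) (neighbors_sub_setC1 v) deg_v cardC.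
by rewrite (signless_form_clique_setC1 _ cliqueC) (sumr_setC1 v); lra.
Qed.

End CliqueOffVertex.

Local Close Scope ring_scope.

Theorem theorem4p12 (R : realType) (n : nat) (hn : 6 <= n)
    (p : nat) (hp : 1 <= p <= n - 4)
    (G : sgraph) (hG : is_Ka n p G)
    (k : nat) (hk : 1 <= k) :
  property_rho R (iterated_line_graph k G).
Proof.
have [v [cliqueC cardG deg_v]] := is_Ka_clique hG.
have deg_v_ge3 : 3 <= degree v by lia.
have cardG_ge6 : 6 <= #|G| by rewrite cardG.
case: k hk => // k _; apply: property_rho_line_graph.
case: k => [|k]; first exact: psdmx_signless_laplacian_clique_setC1 cliqueC _ _.
have deg_ge3 : forall x : iterated_line_graph k G, 3 <= degree x.
  apply: degree_iterated_line_graph_geq => //.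
  by apply: clique_setC1_degree_geq cliqueC _ deg_v_ge3; lia.
apply: psdmx_signless_laplacian_line_graph => e; rewrite -natrD ler_nat.
exact: degree_line_graph_geq deg_ge3 e.
Qed.
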